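(* Let $(n,k,r)$ be an admissible triple of parameters, i.e. $n\in\mathbb{N}$, $k\in\{0,\ldots,n\}$, $r\in[0,\infty)$ and $\max\{k,r\}>0$. Then the $r$-Lah distribution $\mathrm{Lah}(n,k)_r$ is log-concave, that is $$\mathbb{P}[\mathrm{Lah}(n,k)_r=i]^2\geq\mathbb{P}[\mathrm{Lah}(n,k)_r=i-1]\,\mathbb{P}[\mathrm{Lah}(n,k)_r=i+1]$$ for all $i\in\{k+1,\ldots,n-1\}$.
   Context: $\mathbb{N}=\{1,2,\ldots\}$, $\mathbb{N}_0=\mathbb{N}\cup\{0\}$. Let $\genfrac{[}{]}{0pt}{}{n}{k}$ and $\genfrac{\{}{\}}{0pt}{}{n}{k}$ be the (unsigned) Stirling numbers of the first kind (number of permutations of $\{1,\dots,n\}$ with exactly $k$ cycles) and of the second kind (number of partitions of $\{1,\dots,n\}$ into $k$ non-empty subsets). For $n\in\mathbb{N}_0$, $k\in\{0,\ldots,n\}$ and $r\in\mathbb{R}$ the $r$-Stirling numbers are defined (with $0^0=1$) by $$\genfrac{[}{]}{0pt}{}{n}{k}_r=\sum_{j=k}^n\genfrac{[}{]}{0pt}{}{n}{j}\binom{j}{k}r^{j-k},\qquad \genfrac{\{}{\}}{0pt}{}{n}{k}_r=\sum_{j=k}^n\binom{n}{j}\genfrac{\{}{\}}{0pt}{}{j}{k}r^{n-j}.$$ The $r$-Lah number is $L(n,k)_r=\sum_{j=k}^n\genfrac{[}{]}{0pt}{}{n}{j}_r\genfrac{\{}{\}}{0pt}{}{j}{k}_r$.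 For an admissible triple $(n,k,r)$, $\mathrm{Lah}(n,k)_r$ denotes a random variable with the $r$-Lah distribution $$\mathbb{P}[\mathrm{Lah}(n,k)_r=j]=\frac{1}{L(n,k)_r}\genfrac{[}{]}{0pt}{}{n}{j}_r\genfrac{\{}{\}}{0pt}{}{j}{k}_r,\qquad j\in\{k,k+1,\ldots,n\}.$$ *)

(* Defs.v *)
From HB Require Import structures.
From mathcomp Require Import all_boot all_order all_algebra all_fingroup.
From mathcomp Require Import all_classical all_reals all_analysis.
Set Implicit Arguments.
Unset Strict Implicit.
Unset Printing Implicit Defensive.
Import Order.TTheory GRing.Theory Num.Theory.
Local Open Scope ring_scope.

Definition stirling1 (n k : nat) : nat :=
  #|[set s : 'S_n | #|porbits s| == k]|.

Definition stirling2 (n k : nat) : nat :=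
  #|[set Q : {set {set 'I_n}} | finset.partition Q [set: 'I_n] & #|Q| == k]|.

Definition rstirling1 (R : realType) (r : R) (n k : nat) : R :=
  \sum_(k <= j < n.+1) (stirling1 n j)%:R * 'C(j, k)%:R * r ^+ (j - k).

Definition rstirling2 (R : realType) (r : R) (n k : nat) : R :=
  \sum_(k <= j < n.+1) 'C(n, j)%:R * (stirling2 j k)%:R * r ^+ (n - j).

Definition rlah (R : realType) (r : R) (n k : nat) : R :=
  \sum_(k <= j < n.+1) rstirling1 r n j * rstirling2 r j k.

Definition rlah_admissible (R : realType) (n k : nat) (r : R) : Prop :=
  [/\ (0 < n)%N, (k <= n)%N, 0 <= r & 0 < Num.max k%:R r].

(* The prescribed masses are nonnegative and add up to 1 for an admissible     *)
(* triple, so they determine the law of X; see rlah_distributed_exists.        *)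
Definition rlah_distributed (R : realType) (d : measure_display)
    (T : measurableType d) (P : probability T R) (X : {RV P >-> nat})
    (n k : nat) (r : R) : Prop :=
  forall j : nat, (k <= j <= n)%N ->
    P (X @^-1` [set j])%classic =
      ((rlah r n k)^-1 * (rstirling1 r n j * rstirling2 r j k))%:E.

Lemma stirling1_diag_gt0 (n : nat) : (0 < stirling1 n n)%N.
Proof.
apply/card_gt0P; exists 1%g; rewrite inE.
have -> : porbits (1 : 'S_n)%g = [set [set x] | x : 'I_n].
  apply: eq_imset => x; apply/setP => y; rewrite inE.
  apply/porbitP/eqP => [[i ->]|->]; first by rewrite expg1n perm1.
  by exists 0; rewrite expg0 perm1.
by rewrite card_imset ?card_ord //; exact: set1_inj.
Qed.

Lemma stirling2_gt0 (n k : nat) : (0 < k <= n)%N -> (0 < stirling2 n k)%N.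
Proof.
case: k => // k /= kn; apply/card_gt0P.
pose f (x : 'I_n) : 'I_k.+1 := inord (minn x k).
have fE (x : 'I_n) : f x = minn x k :> nat by rewrite inordK // ltnS geq_minr.
exists (preim_partition f [set: 'I_n]%SET).
rewrite inE preim_partitionP /=.
pose g (z : 'I_k.+1) := [set y : 'I_n | f y == z]%SET.
pose h (z : 'I_k.+1) : 'I_n := Ordinal (leq_trans (ltn_ord z) kn).
have fh z : f (h z) = z.
  by apply: val_inj; rewrite /= fE /=; apply/minn_idPl; rewrite -ltnS.
have -> : preim_partition f [set: 'I_n]%SET = [set g z | z : 'I_k.+1]%SET.
  apply/setP => B; apply/imsetP/imsetP => [[x _ ->]|[z _ ->]].
    by exists (f x) => //; apply/setP => y; rewrite !inE /= eq_sym.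
  by exists (h z) => //; apply/setP => y; rewrite !inE /= fh eq_sym.
rewrite card_imset ?card_ord // => z1 z2 /setP/(_ (h z1)).
by rewrite !inE fh eqxx => /esym/eqP.
Qed.

Lemma stirling200 : (0 < stirling2 0 0)%N.
Proof.
apply/card_gt0P; exists finset.set0; rewrite inE cards0 eqxx andbT.
apply/and3P; split; last by rewrite inE.
  by rewrite /finset.cover big_set0; apply/eqP/setP => -[].
by apply/finset.trivIsetP => A B; rewrite inE.
Qed.

Lemma rstirling1_ge0 (R : realType) (r : R) (n k : nat) :
  0 <= r -> 0 <= rstirling1 r n k.
Proof.
by move=> r0; apply: sumr_ge0 => j _; rewrite !mulr_ge0 // exprn_ge0.
Qed.

Lemma rstirling2_ge0 (R : realType) (r : R) (n k : nat) :
  0 <= r -> 0 <= rstirling2 r n k.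
Proof.
by move=> r0; apply: sumr_ge0 => j _; rewrite !mulr_ge0 // exprn_ge0.
Qed.

Lemma rlah_gt0 (R : realType) (n k : nat) (r : R) :
  rlah_admissible n k r -> 0 < rlah r n k.
Proof.
case=> n0 kn r0 kr0.
rewrite /rlah big_nat_recr //= ltr_wpDl //.
  by apply: sumr_ge0 => j _; rewrite mulr_ge0 // ?rstirling1_ge0 ?rstirling2_ge0.
rewrite mulr_gt0 //.
  rewrite /rstirling1 big_nat1 subnn expr0 binn !mulr1 ltr0n.
  exact: stirling1_diag_gt0.
have [k0|k0] := posnP k.
  have {}r0 : 0 < r by move: kr0; rewrite k0 lt_max ltxx.
  rewrite k0 /rstirling2 big_nat_recl //= ltr_wpDr //.
    by apply: sumr_ge0 => j _; rewrite !mulr_ge0 // exprn_ge0 // ltW.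
  by rewrite bin0 mul1r mulr_gt0 ?exprn_gt0 // ltr0n stirling200.
rewrite /rstirling2 big_nat_recr //= ltr_wpDl //.
  by apply: sumr_ge0 => j _; rewrite !mulr_ge0 // exprn_ge0.
by rewrite subnn expr0 binn mul1r mulr1 ltr0n stirling2_gt0 // k0.
Qed.

Lemma rlah_distributed_exists (R : realType) (n k : nat) (r : R) :
  rlah_admissible n k r ->
  exists (P : probability nat R) (X : {RV P >-> nat}),
    rlah_distributed X n k r.
Proof.
move=> adm; have L0 := rlah_gt0 adm; case: adm => n0 kn r0 _.
pose p j := (rlah r n k)^-1 * (rstirling1 r n j * rstirling2 r j k).
have p0 j : 0 <= p j.
  by rewrite !mulr_ge0 ?invr_ge0 ?(ltW L0) ?rstirling1_ge0 ?rstirling2_ge0.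
pose m : {measure set nat -> \bar R} :=
  msum (fun j => mscale (NngNum (p0 j)) (\d_j : {measure set nat -> \bar R}))
    n.+1.
have mE A : m A = (\sum_(0 <= j < n.+1) p j * \1_A j)%:E.
  rewrite /m /= /msum -(big_mkord xpredT (fun j => mscale (NngNum (p0 j)) \d_j A)).
  rewrite -sumEFin; apply: eq_bigr => j _.
  by rewrite /mscale /= diracE indicE -EFinM.
have mT : m setT = 1%E.
  rewrite mE; congr EFin.
  rewrite (big_cat_nat _ (n := k)) //= ?leqW //.
  rewrite big_nat_cond big1 ?add0r; last first.
    move=> j /andP[/andP[_ jk] _].
    by rewrite /p /rstirling2 big_geq // !mulr0 mul0r.
  under eq_bigr do rewrite indicT mulr1.
  by rewrite -mulr_sumr mulVf // gt_eqF.
pose P : probability nat R := mnormalize m (\d_0%N : probability nat R).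
have PE A : P A = m A.
  rewrite /P /= /mnormalize -/m mT onee_eq0 /=.
  by rewrite invr1 mule1.
have mid : measurable_fun [set: nat] (@id nat) by exact: measurable_id.
pose X : {RV P >-> nat} := HB.pack (@id nat) (isMeasurableFun.Build _ _ _ _ _ mid).
exists P, X => j /andP[kj jn].
rewrite [LHS]PE mE; congr EFin.
have jI : j \in index_iota 0 n.+1 by rewrite mem_index_iota ltnS.
rewrite (bigD1_seq j jI (iota_uniq _ _)) /=.
rewrite indicE mem_set //= mulr1 big1 => [|i ij]; first by rewrite addr0.
by rewrite indicE memNset ?mulr0 //= => ji; rewrite ji eqxx in ij.
Qed.

(* Main.v *)
(** Up to a constant, the mass function is the product of a row of r-Stirling
    numbers of the first kind and a column of r-Stirling numbers of the second
    kind, so it suffices that both factors are log-concave without internal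
    zeros. This property says that the Toeplitz matrix of the sequence is
    totally positive of order 2, hence it is stable under convolution by the
    Cauchy-Binet formula. The row consists of the coefficients of
    [\prod_(i < n) ('X + (r + i))], a convolution of two-term sequences; the
    column of index [k.+1] is, by its triangular recurrence, the convolution of
    the delayed column of index [k] with the powers of [r + k.+1]. *)

Require Import Defs.
From mathcomp Require Import all_classical all_reals all_analysis.
(* Loaded after [all_classical], so that [set0], [partition], etc. denote the
   notions of [finset]. *)
From mathcomp Require Import all_boot all_order all_algebra all_fingroup.
From mathcomp Require Import ring zify.
Set Implicit Arguments.
Unset Strict Implicit.
Unset Printing Implicit Defensive.
Import Order.TTheory GRing.Theory Num.Theory.
Local Open Scope ring_scope.

Section total_positivity.
Context {R : numDomainType}.

Definition totally_positive2 {d d' : Order.disp_t} {I : porderType d}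
    {J : porderType d'} (K : I -> J -> R) : Prop :=
  forall i i' j j', (i <= i')%O -> (j <= j')%O ->
    K i j' * K i' j <= K i j * K i' j'.

(* Cauchy-Binet: a 2x2 minor of the composite is the sum, over the pairs
   [k < l], of the products of the corresponding minors of [K] and [L]. Letting
   [(k, l)] range over all pairs instead counts each product twice. *)
Lemma totally_positive2_comp (d d' d'' : Order.disp_t) (I : porderType d)
    (J : orderType d') (H : porderType d'') (K : I -> J -> R) (L : J -> H -> R)
    (s : seq J) :
  totally_positive2 K -> totally_positive2 L ->
  totally_positive2 (fun i h => \sum_(j <- s) K i j * L j h).
Proof.
move=> tpK tpL i i' h h' ii' hh'.
pose minorK k l := K i k * K i' l - K i l * K i' k.
pose minorL k l := L k h * L l h' - L k h' * L l h.
have minor_ge0 k l : 0 <= minorK k l * minorL k l.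
  case/orP: (le_total k l) => kl.
    by rewrite mulr_ge0 ?subr_ge0 ?tpK ?tpL.
  rewrite mulr_le0 ?subr_le0 ?tpK // mulrC [leRHS]mulrC; exact: tpL.
pose C x y := \sum_(j <- s) K x j * L j y.
have C_mul x y x' y' : C x y * C x' y' =
    \sum_(k <- s) \sum_(l <- s) K x k * L k y * (K x' l * L l y').
  exact: big_distrlr.
have twice_minor : (C i h * C i' h' - C i h' * C i' h) *+ 2 =
    \sum_(k <- s) \sum_(l <- s) minorK k l * minorL k l.
  rewrite mulr2n {2}[C i h * _]mulrC {2}[C i h' * _]mulrC !C_mul -!sumrB.
  rewrite -big_split; apply: eq_bigr => k _; rewrite -!sumrB -big_split.
  by apply: eq_bigr => l _; rewrite /minorK /minorL /=; ring.
rewrite -subr_ge0 -(pmulrn_lge0 _ (isT : 0 < 2)%N) twice_minor.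
by apply: sumr_ge0 => k _; apply: sumr_ge0.
Qed.

End total_positivity.

Section log_concavity.
Context {R : numDomainType}.
Implicit Types (a b : nat -> R) (c : R).

(* Unlike [a i.-1 * a i.+1 <= a i ^+ 2], this condition excludes internal
   zeros, which makes it stable under convolution. *)
Definition log_concave a : Prop :=
  (forall i, 0 <= a i) /\
  (forall i j, (i <= j)%N -> a i * a j.+1 <= a i.+1 * a j).

Definition toeplitz a (i j : nat) : R := if (i <= j)%N then a (j - i)%N else 0.

Definition convolution a b (n : nat) : R :=
  \sum_(i < n.+1) a i * b (n - i)%N.

Definition delay a (n : nat) : R := if n is m.+1 then a m else 0.

Lemma eq_log_concave a b : a =1 b -> log_concave a -> log_concave b.
Proof. by move=> ab [a0 lca]; split=> [i|i j]; rewrite -!ab; auto. Qed.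

Lemma log_concave_sqr a i :
  log_concave a -> a i * a i.+2 <= a i.+1 ^+ 2.
Proof. by move=> [_ lca]; rewrite expr2 lca. Qed.

Lemma log_concave_mul a b :
  log_concave a -> log_concave b -> log_concave (fun i => a i * b i).
Proof.
move=> [a0 lca] [b0 lcb]; split=> [i|i j ij]; first by rewrite mulr_ge0.
by rewrite mulrACA [leRHS]mulrACA ler_pM ?mulr_ge0 ?lca ?lcb.
Qed.

Lemma log_concave_addl a m i j :
  log_concave a -> (i <= j)%N -> a i * a (m + j)%N <= a (m + i)%N * a j.
Proof.
move=> [_ lca]; elim: m i => [//|m IH] i.
rewrite leq_eqVlt => /predU1P[->|ij]; first by rewrite mulrC.
apply: le_trans (lca _ _ (leq_trans (ltnW ij) (leq_addl m j))) _.
by rewrite addSnnS IH.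
Qed.

Lemma log_concave_toeplitz a : log_concave a -> totally_positive2 (toeplitz a).
Proof.
move=> lca i i' j j'; rewrite !leEnat /toeplitz => ii' jj'.
have a0 := lca.1.
have [i'j|ji'] := leqP i' j; last first.
  by rewrite mulr0 mulr_ge0 //; case: ifP.
have [ij ij'] := (leq_trans ii' i'j, leq_trans i'j jj').
rewrite ij ij' (leq_trans ij jj').
have addBB n : (i' <= n)%N -> (i' - i + (n - i') = n - i)%N.
  by move=> i'n; rewrite addnC addnBA // subnK.
have := log_concave_addl (i' - i) lca (leq_sub2r i' jj').
by rewrite mulrC !addBB // (leq_trans i'j).
Qed.

Lemma toeplitz_convolution a b N i j : (j < N)%N ->
  toeplitz (convolution a b) i j =
  \sum_(0 <= k < N) toeplitz a i k * toeplitz b k j.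
Proof.
move=> jN; rewrite /toeplitz.
rewrite (big_cat_nat (n := j.+1)) //= [X in _ + X]big_nat_cond.
rewrite [X in _ + X]big1 ?addr0 => [|k /andP[/andP[jk _] _]]; last first.
  by rewrite [(k <= j)%N]leqNgt jk mulr0.
have [ij|ji] := leqP i j; last first.
  rewrite big_nat_cond big1 // => k /andP[/andP[_ kj] _].
  by rewrite leqNgt (leq_trans kj ji) mul0r.
rewrite (big_cat_nat (n := i)) ?leqW //= [X in X + _]big_nat_cond.
rewrite [X in X + _]big1 ?add0r => [|k /andP[/andP[_ ki] _]]; last first.
  by rewrite leqNgt ki mul0r.
rewrite -{2}[i]add0n big_addn subSn // big_mkord; apply: eq_bigr => k _.
rewrite leq_addl addnK addnC -leq_subRL // -ltnS ltn_ord.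
by rewrite subnDA.
Qed.

Lemma log_concave_convolution a b :
  log_concave a -> log_concave b -> log_concave (convolution a b).
Proof.
move=> lca lcb; split=> [i|i j ij].
  by apply: sumr_ge0 => k _; rewrite mulr_ge0 ?lca.1 ?lcb.1.
have [tpa tpb] := (log_concave_toeplitz lca, log_concave_toeplitz lcb).
have := totally_positive2_comp (index_iota 0 j.+2) tpa tpb.
move=> /(_ 0 1 i.+1 j.+1 isT ij).
by rewrite -!toeplitz_convolution // /toeplitz !subn0 !subn1 mulrC.
Qed.

Lemma log_concave_delay a : log_concave a -> log_concave (delay a).
Proof.
move=> [a0 lca]; split=> [[|i]|[|i] [|j]] //=; rewrite ?mul0r ?mulr_ge0 //.
by rewrite ltnS => /lca.
Qed.

Lemma log_concave_geometric c : 0 <= c -> log_concave (GRing.exp c).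
Proof.
move=> c0; split=> [i|i j _]; first exact: exprn_ge0.
by rewrite -!exprD addnS.
Qed.

Lemma affine_recurrence_convolution a b c :
  b 0%N = a 0%N -> (forall n, b n.+1 = c * b n + a n.+1) ->
  b =1 convolution (GRing.exp c) a.
Proof.
move=> b0 bS; elim=> [|n IH]; first by rewrite /convolution big_ord1 mul1r.
rewrite bS IH /convolution [RHS]big_ord_recl mul1r addrC mulr_sumr.
by congr (_ + _); apply: eq_bigr => j _; rewrite mulrA -exprS.
Qed.

Lemma log_concave_coef_XaddC c :
  0 <= c -> log_concave (fun i => ('X + c%:P)`_i).
Proof.
move=> c0; rewrite polyseqXaddC.
by split=> [[|[|i]]|[|i] [|[|j]]] //=; rewrite ?nth_nil ?mulr0 ?mul0r // mulrC.
Qed.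

Lemma log_concave_coef_prod_XaddC (I : Type) (s : seq I) (c : I -> R) :
  (forall i, 0 <= c i) ->
  log_concave (fun k => (\prod_(i <- s) ('X + (c i)%:P))`_k).
Proof.
move=> c0; elim/big_ind: _ => [|p q lcp lcq|i _].
- by apply: eq_log_concave (log_concave_geometric (lexx 0)) => i;
    rewrite coef1 expr0n.
- apply: eq_log_concave (log_concave_convolution lcp lcq) => i.
  by rewrite coefM.
- exact: log_concave_coef_XaddC.
Qed.

End log_concavity.

Section binomial_transform.
Context {R : comPzSemiRingType}.
Implicit Types (r c : R) (a b : nat -> R).

Definition binomial_transform r a (n : nat) : R :=
  \sum_(i < n.+1) (r ^+ (n - i) * a i) *+ 'C(n, i).

Lemma eq_binomial_transform r a b n :
  a =1 b -> binomial_transform r a n = binomial_transform r b n.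
Proof. by move=> ab; apply: eq_bigr => i _; rewrite ab. Qed.

Lemma binomial_transform1 a n :
  binomial_transform 1 a n = \sum_(i < n.+1) a i *+ 'C(n, i).
Proof. by apply: eq_bigr => i _; rewrite expr1n mul1r. Qed.

Lemma binomial_transform_at0 r a : binomial_transform r a 0 = a 0%N.
Proof. by rewrite /binomial_transform big_ord1 mul1r. Qed.

Lemma binomial_transform_lin r a b c n :
  binomial_transform r (fun i => a i + c * b i) n =
  binomial_transform r a n + c * binomial_transform r b n.
Proof.
rewrite /binomial_transform mulr_sumr -big_split; apply: eq_bigr => i _ /=.
by rewrite mulrDr mulrnDl mulrCA mulrnAr.
Qed.

Lemma binomial_transformS r a n :
  binomial_transform r a n.+1 =
  r * binomial_transform r a n + binomial_transform r (a \o succn) n.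
Proof.
rewrite {1}/binomial_transform big_ord_recl.
under eq_bigr do rewrite lift0 binS mulrnDr subSS.
rewrite big_split /= addrA; congr (_ + _).
rewrite big_ord_recr /= (bin_small (ltnSn n)) mulr0n addr0.
rewrite /binomial_transform [in RHS]big_ord_recl mulrDr mulr_sumr !bin0 !subn0.
rewrite exprS mulrA; congr (_ + _); apply: eq_bigr => i _.
by rewrite lift0 mulrnAr mulrA -exprS subnSK.
Qed.

End binomial_transform.

Lemma sum_card_fiber (V : nmodType) (I : finType) (P : pred I) (f : I -> nat)
    (F : nat -> V) (N : nat) :
  (forall i, P i -> (f i < N)%N) ->
  \sum_(i | P i) F (f i) = \sum_(j < N) F j *+ #|[set i | P i & f i == j]|.
Proof.
case: N => [|N] fN.
  by rewrite big_ord0 big_pred0 // => i; apply: contraTF isT => /fN.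
rewrite (partition_big (fun i => inord (f i) : 'I_N.+1) xpredT) //=.
apply: eq_bigr => j _; rewrite -sumr_const.
apply: eq_big => [i|i /andP[Pi /eqP<-]]; last by rewrite inordK // fN.
by rewrite inE; apply: andb_id2l => Pi; rewrite -val_eqE /= inordK // fN.
Qed.

Lemma sum_subset_card (V : nmodType) (T : finType) (D : {set T})
    (F : nat -> V) :
  \sum_(C : {set T} | C \subset D) F #|C| =
  \sum_(j < #|D|.+1) F j *+ 'C(#|D|, j).
Proof.
rewrite (sum_card_fiber F (N := #|D|.+1)) => [|C /subset_leq_card//].
by apply: eq_bigr => j _; rewrite -cards_draws.
Qed.

Lemma set_ind (T : finType) (P : {set T} -> Prop) :
  P set0 -> (forall x (D : {set T}), x \notin D -> P D -> P (x |: D)) ->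
  forall D, P D.
Proof.
move=> P0 PU D; have [m] := ubnP #|D|; elim: m D => // m IH D.
have [->//|[x xD]] := set_0Vmem D.
rewrite ltnS (cardsD1 x) xD -{2}(setD1K xD) => Dm.
by apply: PU; [rewrite setD11 | apply: IH].
Qed.

Section permutations.
Variable T : finType.
Implicit Types (s t : {perm T}) (x y : T) (D : {set T}).

Lemma perm_on_tperm x y D : x \in D -> y \in D -> perm_on D (tperm x y).
Proof.
move=> xD yD; apply: subset_trans (tperm_on x y) _.
by rewrite subUset !sub1set xD.
Qed.

Lemma perm_on_mull t s D : perm_on D t -> perm_on D (t * s)%g = perm_on D s.
Proof.
move=> tD; apply/idP/idP => [tsD|]; last exact: perm_onM.
by rewrite -(mulKg t s) perm_onM ?perm_onV.
Qed.

Lemma perm_on_setU1_fix s x D :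
  x \notin D -> perm_on (x |: D) s && (s x == x) = perm_on D s.
Proof.
move=> xD; apply/andP/idP => [[sD /eqP sx]|sD]; last first.
  by rewrite (out_perm sD) //; split; first exact: subset_trans (subsetUr _ _).
apply/subsetP => y sy; have /setU1P[yx|//] := subsetP sD y sy.
by rewrite inE yx sx eqxx in sy.
Qed.

Lemma big_perm_on_setU1 (R : Type) (idx : R) (op : Monoid.com_law idx) x D
    (F : {perm T} -> R) :
  x \notin D ->
  \big[op/idx]_(s | perm_on (x |: D) s) F s =
  \big[op/idx]_(y in x |: D) \big[op/idx]_(s | perm_on D s) F (tperm x y * s)%g.
Proof.
move=> xD; pose preim_x (s : {perm T}) := (s^-1)%g x.
rewrite (partition_big preim_x (mem (x |: D))) => [|s sD] /=; last first.
  by rewrite (perm_closed _ (perm_onV sD)) setU11.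
apply: eq_bigr => y yD; rewrite (reindex_inj (mulgI (tperm x y))).
apply: eq_bigl => s; rewrite perm_on_mull ?perm_on_tperm ?setU11 //.
rewrite -(perm_on_setU1_fix s xD) /preim_x; congr (_ && _).
by rewrite (can2_eq (permKV _) (permK _)) permM tpermR eq_sym.
Qed.

Lemma porbit_fix s x : s x = x -> porbit s x = [set x].
Proof.
move=> sx; apply/setP => y; rewrite inE.
apply/porbitP/eqP => [[i ->]|->]; last by exists 0%N; rewrite perm1.
by rewrite permX iter_fix.
Qed.

Lemma card_porbits_on s D :
  perm_on D s -> #|porbits s| = (#|porbit s @: D| + #|~: D|)%N.
Proof.
move=> sD; have fixD x : x \in ~: D -> porbit s x = [set x].
  by rewrite inE => xD; rewrite porbit_fix // (out_perm sD).
have -> : #|~: D| = #|porbit s @: ~: D|.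
  by rewrite (eq_in_imset fixD) card_imset //; exact: set1_inj.
have -> : porbits s = porbit s @: (D :|: ~: D).
  rewrite setUCr; apply/setP => B.
  by apply/imsetP/imsetP => -[x _ ->]; exists x.
rewrite imsetU cardsU disjoint_setI0 ?cards0 ?subn0 //.
apply/pred0Pn => -[_ /andP[/imsetP[x xD ->] /imsetP[y yD]]].
rewrite (fixD _ yD) => xy; have := porbit_id s x.
by rewrite xy inE => /eqP x_y; rewrite -x_y inE xD in yD.
Qed.

Lemma card_porbit_imset_setU1 s x D :
  x \notin D -> perm_on D s -> #|porbit s @: (x |: D)| = #|porbit s @: D|.+1.
Proof.
move=> xD sD; rewrite imsetU1 cardsU1 porbit_fix ?(out_perm sD) //.
suff -> : [set x] \notin porbit s @: D by [].
apply: contraNN xD => /imsetP[y yD xy].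
by have := porbit_id s y; rewrite -xy inE => /eqP <-.
Qed.

Lemma card_porbit_imset_mul_tperm s x y D :
  x \notin D -> y \in D -> perm_on D s ->
  #|porbit (tperm x y * s)%g @: (x |: D)| = #|porbit s @: D|.
Proof.
move=> xD yD sD; have sx := out_perm sD xD.
have xy : x != y by apply: contraNneq xD => ->.
have xsy : x \notin porbit s y.
  by rewrite porbit_sym porbit_fix // inE eq_sym.
have tsD : perm_on (x |: D) (tperm x y * s)%g.
  rewrite perm_on_mull; first exact: subset_trans sD (subsetUr _ _).
  by rewrite perm_on_tperm ?setU11 ?setU1r.
have /= := porbits_mul_tperm s x y.
rewrite xy xsy (card_porbits_on tsD) (card_porbits_on sD) setCU.
by rewrite (cardsD1 x (~: D)) inE xD setDE setIC /= -[true.*2]/2%N; lia.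
Qed.

Lemma sum_perm_on_exp_porbits (R : pzSemiRingType) (t : R) D :
  \sum_(s | perm_on D s) t ^+ #|porbit s @: D| = \prod_(i < #|D|) (t + i%:R).
Proof.
elim/set_ind: D => [|x D xD IH].
  rewrite cards0 big_ord0 (big_pred1 1%g) ?imset0 ?cards0 // => s.
  by apply/idP/eqP => [sD|->]; rewrite ?perm_on1 // (perm_on_id sD) ?cards0.
rewrite big_perm_on_setU1 // big_setU1 //= tperm1 cardsU1 xD big_ord_recr /=.
rewrite -IH mulrDr mulr_suml mulr_natr -sumr_const; congr (_ + _).
  by apply: eq_bigr => s sD; rewrite mul1g card_porbit_imset_setU1 // exprSr.
apply: eq_bigr => y yD; apply: eq_bigr => s sD.
by rewrite card_porbit_imset_mul_tperm.
Qed.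

Lemma sum_perm_exp_porbits (R : pzSemiRingType) (t : R) :
  \sum_(s : {perm T}) t ^+ #|porbits s| = \prod_(i < #|T|) (t + i%:R).
Proof.
have onT s : perm_on [set: T] s by apply/subsetP => x; rewrite inE.
rewrite -cardsT -sum_perm_on_exp_porbits.
apply: eq_big => s; first by rewrite onT.
by rewrite (card_porbits_on (onT s)) setCT cards0 addn0.
Qed.

End permutations.

Lemma sum_stirling1_exp (R : pzSemiRingType) (n : nat) (t : R) :
  \sum_(j < n.+1) t ^+ j *+ stirling1 n j = \prod_(i < n) (t + i%:R).
Proof.
have porbits_le (s : 'S_n) : (#|porbits s| < n.+1)%N.
  by rewrite ltnS -[leqRHS]card_ord leq_imset_card.
rewrite -[in RHS](card_ord n) -sum_perm_exp_porbits.
by rewrite (sum_card_fiber (GRing.exp t) (fun s _ => porbits_le s)).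
Qed.

Section partitions.
Local Open Scope nat_scope.

Lemma setU1_notin_partition (T : finType) (Q : {set {set T}}) (x : T)
    (C D : {set T}) :
  x \notin D -> partition Q D -> x |: C \notin Q.
Proof.
move=> xD QD; apply: contraNN xD => /(partitionS QD)/subsetP; apply.
exact: setU11.
Qed.

Lemma setDU1_setU1 (T : finType) (x : T) (C D : {set T}) :
  x \notin D -> (x |: D) :\: (x |: C) = D :\: C.
Proof.
move=> xD; apply/setP => y; rewrite !inE.
by case: eqVneq => [->|//]; rewrite (negbTE xD) andbF.
Qed.

Lemma partition_setU1_block (T : finType) (Q : {set {set T}}) (x : T)
    (C D : {set T}) :
  x \notin D -> C \subset D -> partition Q (D :\: C) ->
  partition ((x |: C) |: Q) (x |: D).
Proof.
move=> xD CD QD; have -> : x |: D = (x |: C) :|: D :\: C.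
  by rewrite -setUA -{1}(setIidPr CD) setID.
apply: partitionU1 => //; first by apply/set0Pn; exists x; exact: setU11.
by rewrite -(setDU1_setU1 C xD) disjoint_sym disjoints_subset subsetDr.
Qed.

(* [x |: C] is the block of [x], and [Q] the set of the other blocks. *)
Lemma big_partition_setU1 (R : Type) (idx : R) (op : Monoid.com_law idx)
    (T : finType) (x : T) (D : {set T}) (F : {set {set T}} -> R) :
  x \notin D ->
  \big[op/idx]_(Q | partition Q (x |: D)) F Q =
  \big[op/idx]_(C : {set T} | C \subset D)
    \big[op/idx]_(Q | partition Q (D :\: C)) F ((x |: C) |: Q).
Proof.
move=> xD; have x_cover Q : partition Q (x |: D) -> x \in cover Q.
  by move=> QD; rewrite (cover_partition QD) setU11.
rewrite (partition_big (fun Q => pblock Q x :\ x) (fun C => C \subset D)) /=.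
  apply: eq_bigr => C CD.
  have xC : x \notin C by apply: contraNN xD; exact: (subsetP CD).
  rewrite (reindex_onto (fun Q => (x |: C) |: Q) (fun Q => Q :\ (x |: C))).
    apply: eq_bigl => Q; apply/andP/idP => [[/andP[QD _] /eqP <-]|QD].
      by rewrite -(setDU1_setU1 C xD) partitionD1 // setU11.
    have QxD := partition_setU1_block xD CD QD.
    have pblock_x : pblock ((x |: C) |: Q) x = x |: C.
      by apply: def_pblock (partition_trivIset QxD) _ _; exact: setU11.
    rewrite QxD pblock_x !setU1K ?eqxx //.
    by rewrite (setU1_notin_partition _ _ QD) // inE (negbTE xD) andbF.
  move=> Q /andP[QD /eqP QC].
  have -> : x |: C = pblock Q x by rewrite -QC setD1K // mem_pblock x_cover.
  by rewrite setD1K // pblock_mem ?x_cover.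
move=> Q QD; rewrite -(setU1K xD) setSD //.
exact: partitionS QD (pblock_mem (x_cover _ QD)).
Qed.

Definition partitions_into (T : finType) (k : nat) (D : {set T}) :
    {set {set {set T}}} :=
  [set Q | partition Q D & #|Q| == k].

Lemma card_partitions_into_setU1 (T : finType) (x : T) (D : {set T})
    (k : nat) :
  x \notin D ->
  #|partitions_into k.+1 (x |: D)| =
  \sum_(C : {set T} | C \subset D) #|partitions_into k C|.
Proof.
move=> xD; rewrite -sum1dep_card big_mkcondr big_partition_setU1 //.
rewrite (reindex_onto (fun C => D :\: C) (fun C => D :\: C)) /= => [|C CD].
  apply: eq_big => [C|C /andP[_ /eqP DDC]].
    by rewrite subsetDl setDDr setDv set0U; apply/eqP/setIidPr.
  rewrite DDC -sum1dep_card [RHS]big_mkcondr; apply: eq_bigr => Q QC.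
  rewrite cardsU1 (setU1_notin_partition _ _ QC) //.
  by rewrite -DDC inE (negbTE xD) andbF.
by rewrite setDDr setDv set0U; apply/setIidPr.
Qed.

Lemma set0_partition (T : finType) (D : {set T}) :
  partition set0 D = (D == set0).
Proof.
rewrite /partition /cover big_set0 eq_sym inE andbT.
by apply: andb_idr => _; apply/trivIsetP => A B; rewrite inE.
Qed.

Lemma card_partitions_into0 (T : finType) (D : {set T}) :
  #|partitions_into 0 D| = (D == set0).
Proof.
rewrite -set0_partition -sum1dep_card big_mkcondl.
by rewrite (big_pred1 set0) => [|Q]; [case: ifP | exact: cards_eq0].
Qed.

Lemma card_partitions_into_set0 (T : finType) (k : nat) :
  #|partitions_into k (set0 : {set T})| = (k == 0).
Proof.
rewrite -sum1dep_card big_mkcondr (big_pred1 set0) => [|Q].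
  by rewrite cards0 eq_sym; case: ifP.
exact: partition_set0.
Qed.

Lemma card_partitions_into (T : finType) (D : {set T}) (k : nat) :
  #|partitions_into k D| = stirling2 #|D| k.
Proof.
rewrite /stirling2 -/(partitions_into _ _).
elim: k => [|k IH] in T D *.
  by rewrite !card_partitions_into0 -!cards_eq0 cardsT card_ord.
have partitions_setU1 (T' : finType) x (E : {set T'}) : x \notin E ->
    #|partitions_into k.+1 (x |: E)| =
    binomial_transform 1%R (stirling2 ^~ k) #|E|.
  move=> xE; rewrite card_partitions_into_setU1 // binomial_transform1.
  by rewrite -(sum_subset_card _ (stirling2 ^~ k)); apply: eq_bigr.
elim/set_ind: D => [|x D xD _].
  have -> : [set: 'I_#|@set0 T|] = set0.
    by apply/eqP; rewrite -cards_eq0 cardsT card_ord cards0.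
  by rewrite !card_partitions_into_set0.
rewrite cardsU1 xD -(setUCr [set ord0]) !partitions_setU1 ?inE ?eqxx //.
by rewrite cardsC1 card_ord.
Qed.

Lemma stirling2n0 (n : nat) : stirling2 n 0 = (n == 0).
Proof.
by rewrite -[n in LHS]card_ord -cardsT -card_partitions_into
  card_partitions_into0 -cards_eq0 cardsT card_ord.
Qed.

Lemma stirling20S (k : nat) : stirling2 0 k.+1 = 0.
Proof.
have := card_partitions_into (set0 : {set 'I_0}) k.+1.
by rewrite cards0 card_partitions_into_set0 => <-.
Qed.

Lemma stirling2SS_binomial (n k : nat) :
  stirling2 n.+1 k.+1 = binomial_transform 1%R (stirling2 ^~ k) n.
Proof.
have cardn : #|[set~ (ord0 : 'I_n.+1)]| = n by rewrite cardsC1 card_ord.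
rewrite binomial_transform1 -[n in RHS]cardn.
rewrite -(sum_subset_card _ (stirling2 ^~ k)).
under eq_bigr do rewrite -card_partitions_into.
rewrite -(card_partitions_into_setU1 (x := ord0)) ?inE ?eqxx //.
rewrite card_partitions_into.
by rewrite setUCr cardsT card_ord.
Qed.

(* The exponential generating functions [S_k] of the columns satisfy
   [S_(k+1)' = exp * S_k], hence [S_(k+1)'' = S_(k+1)' + exp * S_k'], where the
   recurrence for [S_k'] can be substituted. *)
Lemma stirling2SS (n k : nat) :
  stirling2 n.+1 k.+1 = stirling2 n k + k.+1 * stirling2 n k.+1.
Proof.
have stirling2S m j : stirling2 m.+2 j.+1 =
    stirling2 m.+1 j.+1 + binomial_transform 1%R (stirling2 ^~ j \o succn) m.
  by rewrite !stirling2SS_binomial binomial_transformS mul1r.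
have stirling21S j :
    stirling2 1 j.+1 = stirling2 0 j + j.+1 * stirling2 0 j.+1.
  rewrite stirling2SS_binomial binomial_transform_at0.
  by rewrite stirling20S muln0 addn0.
elim: k n => [|k IH] [|n] //; rewrite stirling2S.
  rewrite /binomial_transform big1 => [|j _]; last first.
    by rewrite /= stirling2n0 mulr0 mul0rn.
  by rewrite stirling2n0 mul1n addn0.
rewrite (eq_binomial_transform _ _ IH).
rewrite (binomial_transform_lin _ _ (stirling2 ^~ k.+1) k.+1%R).
by rewrite -!stirling2SS_binomial [in RHS]mulSn addnCA.
Qed.

Lemma stirling2_small (n k : nat) : n < k -> stirling2 n k = 0.
Proof.
elim: n k => [|n IH] [|k] // nk; first exact: stirling20S.
by rewrite stirling2SS !IH ?muln0 // ltnW.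
Qed.

End partitions.

Lemma coef_XaddC_exp (R : comNzSemiRingType) (c : R) (n k : nat) :
  (('X + c%:P) ^+ n)`_k = c ^+ (n - k) *+ 'C(n, k).
Proof.
rewrite addrC exprDn coef_sum.
under eq_bigr do rewrite coefMn -rmorphXn coefCM coefXn.
have [kn|nk] := ltnP k n.+1; last first.
  rewrite bin_small // mulr0n big1 // => i _.
  by rewrite gtn_eqF ?mulr0 ?mul0rn // (leq_trans (ltn_ord i)).
rewrite (bigD1 (Ordinal kn)) //= eqxx mulr1 big1 ?addr0 // => i ik.
by rewrite eq_sym -val_eqE in ik; rewrite (negbTE ik) mulr0 mul0rn.
Qed.

Section rstirling.
Context {R : realType}.
Variable r : R.

Lemma rstirling1_coef (n k : nat) :
  rstirling1 r n k = (\prod_(i < n) ('X + (r + i%:R)%:P))`_k.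
Proof.
under eq_bigr do rewrite polyCD addrA polyC_natr.
rewrite -sum_stirling1_exp coef_sum /rstirling1 big_geq_mkord big_mkcond /=.
apply: eq_bigr => j _; rewrite coefMn coef_XaddC_exp.
case: leqP => [_|jk]; last by rewrite bin_small // mulr0n mul0rn.
by rewrite -mulrA !mulr_natl.
Qed.

Lemma log_concave_rstirling1 (n : nat) :
  0 <= r -> log_concave (rstirling1 r n).
Proof.
move=> r0; have c0 (i : 'I_n) : 0 <= r + i%:R by rewrite addr_ge0.
apply: eq_log_concave (log_concave_coef_prod_XaddC (index_enum 'I_n) c0) => k.
by rewrite rstirling1_coef.
Qed.

Lemma rstirling2_binomial_transform (n k : nat) :
  rstirling2 r n k = binomial_transform r (fun j => (stirling2 j k)%:R) n.
Proof.
rewrite /rstirling2 big_geq_mkord big_mkcond; apply: eq_bigr => j _ /=.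
case: leqP => [_|jk]; last by rewrite stirling2_small // mulr0 mul0rn.
by rewrite -mulrA mulr_natl [in RHS]mulrC.
Qed.

Lemma rstirling2n0 (n : nat) : rstirling2 r n 0 = r ^+ n.
Proof.
rewrite rstirling2_binomial_transform /binomial_transform big_ord_recl big1.
  by rewrite addr0 stirling2n0 mulr1 subn0 bin0.
by move=> i _; rewrite stirling2n0 mulr0 mul0rn.
Qed.

Lemma rstirling20S (k : nat) : rstirling2 r 0 k.+1 = 0.
Proof.
by rewrite rstirling2_binomial_transform binomial_transform_at0 stirling20S.
Qed.

Lemma rstirling2SS (n k : nat) :
  rstirling2 r n.+1 k.+1 =
  (r + k.+1%:R) * rstirling2 r n k.+1 + rstirling2 r n k.
Proof.
rewrite !rstirling2_binomial_transform binomial_transformS mulrDl -addrA.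
congr (_ + _); rewrite addrC -binomial_transform_lin.
by apply: eq_binomial_transform => j; rewrite /= stirling2SS natrD natrM.
Qed.

Lemma log_concave_rstirling2 (k : nat) :
  0 <= r -> log_concave (rstirling2 r ^~ k).
Proof.
move=> r0; elim: k => [|k IH].
  apply: eq_log_concave (log_concave_geometric r0) => n.
  by rewrite rstirling2n0.
have rk0 : 0 <= r + k.+1%:R by rewrite addr_ge0.
have geom_conv : rstirling2 r ^~ k.+1 =1
    convolution (GRing.exp (r + k.+1%:R)) (delay (rstirling2 r ^~ k)).
  by apply: affine_recurrence_convolution => [|n];
    rewrite ?rstirling20S ?rstirling2SS.
have := log_concave_delay IH.
move=> /(log_concave_convolution (log_concave_geometric rk0)).
by apply: eq_log_concave => n; rewrite geom_conv.
Qed.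

End rstirling.

Local Open Scope classical_set_scope.

Theorem proposition3p14 (R : realType) (n k : nat) (r : R)
    (d : measure_display) (T : measurableType d) (P : probability T R)
    (X : {RV P >-> nat}) (i : nat) :
  rlah_admissible n k r ->
  rlah_distributed X n k r ->
  (k.+1 <= i <= n.-1)%N ->
  (P (X @^-1` [set i.-1]) * P (X @^-1` [set i.+1])
     <= P (X @^-1` [set i]) ^+ 2)%E.
Proof.
case=> [n0 _ r0 _] lawX; case: i => // i; rewrite ltnS => /andP[ki].
rewrite -ltnS (ltn_predK n0) => iN /=.
rewrite !lawX ?ki ?iN ?(leqW ki) ?(leqW (leqW ki)) ?(ltnW iN)
  ?(ltnW (ltnW iN)) //.
rewrite -!EFinM lee_fin mulrACA [leRHS]mulrACA -!expr2.
apply: ler_wpM2l; first exact: sqr_ge0.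
apply: (log_concave_sqr (a := fun j => rstirling1 r n j * rstirling2 r j k)).
by apply: log_concave_mul;
  [exact: log_concave_rstirling1 | exact: log_concave_rstirling2].
Qed.
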